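(* Let $n\ge 1$, let $\vec r=(r_1<\cdots<r_s)$ be an increasing sequence of positive integers less than $n$, let $\vec w\in \mathrm{TFl}^\circ(\vec r,n)$, and let $\mathcal Q(\vec\omega)$ be the coherent mixed subdivision of $\Delta(\vec r,n)$ into flag matroid polytopes induced by $\vec w$. Then there is a closed immersion $$\mathrm{in}_{\vec w}\,\mathrm{Fl}^\circ(\vec r,n)\hookrightarrow \varprojlim_{\mathcal Q(\vec\omega)}\mathrm{Fl}.$$
   Context: Everything is over $\mathbb C$. Flag matroids. An $(r,n)$-matroid is a rank-$r$ matroid on $[n]=\{1,\dots,n\}$, identified with its set of bases $Q\subset\binom{[n]}{r}$. A matroid $Q_1$ is a quotient of $Q_2$ if every flat of $Q_1$ is a flat of $Q_2$. An $(\vec r,n)$-flag matroid is a sequence $\vec Q=(Q_1,\dots,Q_s)$ with $Q_j$ an $(r_j,n)$-matroid and $Q_i$ a quotient of $Q_j$ for $i\le j$. It is uniform if $Q_j=\binom{[n]}{r_j}$ for all $j$. For a finite set $Q$ put $N(Q)=\mathbb Z^Q/\mathbb Z\mathbf 1$ ($\mathbf 1$ the all-ones vector) and $T(Q)=\mathbb G_m^Q/\mathbb G_m$, the torus with cocharacter lattice $N(Q)$. Strata. $\mathrm{Fl}(\vec r,n)$ is the variety of flags $F_1\subset\cdots\subset F_s\subset\mathbb C^n$ with $\dim F_j=r_j$, embedded in $\prod_j\mathbb P(\wedge^{r_j}\mathbb C^n)$ by the Plücker embeddings, with coordinates $p_\lambda$, $\lambda\in\binom{[n]}{r_j}$. For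 $Q\subset\binom{[n]}{r}$, $T(Q)$ is identified with the locally closed subscheme of $\mathbb P(\wedge^r\mathbb C^n)$ where $p_\lambda=0$ for $\lambda\notin Q$ and $p_\lambda\ne0$ for $\lambda\in Q$. The stratum of a flag matroid is the scheme-theoretic intersection $\mathrm{Fl}(\vec Q)=\mathrm{Fl}(\vec r,n)\cap(T(Q_1)\times\cdots\times T(Q_s))$. $\mathrm{Fl}^\circ(\vec r,n)$ is the stratum of the uniform flag matroid, i.e. the open locus where all Plücker coordinates are nonzero. Tropicalization. For a closed subscheme $X^\circ$ of a torus with ideal $I^\circ$ in the Laurent polynomial ring and a real cocharacter $w$, the initial form of $f=\sum c_ux^u$ is the sum of the terms $c_ux^u$ with $\langle u,w\rangle$ minimal, $\mathrm{in}_wI^\circ$ is the ideal generated by the initial forms of elements of $I^\circ$, $\mathrm{Trop}(X^\circ)=\{w:\mathrm{in}_wI^\circ\ne\langle1\rangle\}$, and $\mathrm{in}_wX^\circ$ is the subscheme of the torus cut out by $\mathrm{in}_wI^\circ$. $\mathrm{TFl}^\circ(\vec r,n)\subset\prod_jN(\binom{[n]}{r_j})_{\mathbb R}$ is the tropicalization of $\mathrm{Fl}^\circ(\vec r,n)\subset\prod_jT(\binom{[n]}{r_j})$. Subdivision. For a flag matroid $\vec Q$, $\vec w=(w_1,\dots,w_s)\in\prod_jN(Q_j)_{\mathbb R}$ and $v\in\mathbb R^n/\mathbb R\mathbf 1$, let $(Q_j)^{w_j}_v$ be the set of $\lambda\in Q_j$ minimizing $\sum_{k\in\lambda}v_k+(w_j)_\lambda$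 over $Q_j$ (independent of representatives), and $\vec Q^{\vec w}_v=((Q_1)^{w_1}_v,\dots,(Q_s)^{w_s}_v)$. Set $\mathcal Q(\vec\omega)=\{\vec Q^{\vec w}_v: v\in\mathbb R^n/\mathbb R\mathbf 1\}$, where $\vec\omega$ denotes the data $(\vec Q,\vec w)$ together with $\lambda\mapsto\epsilon^*_\lambda=\sum_{k\in\lambda}\epsilon_k^*$; geometrically this is the coherent mixed subdivision of $\Delta(\vec Q)=\sum_j\mathrm{conv}\{\epsilon^*_\lambda:\lambda\in Q_j\}$ induced by $\vec w$. In the theorem $\vec Q$ is the uniform $(\vec r,n)$-flag matroid, so $\Delta(\vec Q)=\Delta(\vec r,n)$, the Minkowski sum of the hypersimplices $\Delta(r_j,n)$; for $\vec w\in\mathrm{TFl}^\circ(\vec r,n)$ all elements of $\mathcal Q(\vec\omega)$ are flag matroids. Inverse limit. Order flag matroids by $\vec P\le\vec P'$ if $\vec P=(\vec P')^{0}_v$ for some $v$ (i.e. $\Delta(\vec P)$ is a face of $\Delta(\vec P')$). For $\vec P\le\vec P'$ there is a face morphism $\varphi_{\vec P',\vec P}:\mathrm{Fl}(\vec P')\to\mathrm{Fl}(\vec P)$ which keeps the coordinates $p_\lambda$ with $\lambda\in\bigcup_jP_j$ and forgets the others. $\varprojlim_{\mathcal Q(\vec\omega)}\mathrm{Fl}$ is the limit, in affine $\mathbb C$-schemes, of the diagram $\vec P\mapsto\mathrm{Fl}(\vec P)$, $(\vec P\le\vec P')\mapsto\varphi_{\vec P',\vec P}$ over the poset $\mathcal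 Q(\vec\omega)$. *)

(* Defs.v *)
From HB Require Import structures.
From mathcomp Require Import all_boot all_order all_algebra.
From mathcomp Require Import finmap complex boolp reals.
From mathcomp Require Import monalg xfinmap.

Set Implicit Arguments.
Unset Strict Implicit.
Unset Printing Implicit Defensive.

Import Order.TTheory GRing.Theory Num.Theory.
Import BigEnoughFSet.
Local Open Scope fset_scope.
Local Open Scope ring_scope.

(* The group algebra k[M] of an abelian group M: for M a lattice, the ring of
   Laurent polynomials on the torus with character lattice M. The ring
   structure of monalg does not apply, since it is restricted to monoids
   without nontrivial units; g@_u is the coefficient of the character x^u,
   << c *g u >> the term c x^u and msupp g the support. *)
Definition grpalg (k : comNzRingType) (M : zmodType) : Type := {malg k[M]}.

Section GroupAlgebra.
Variables (k : comNzRingType) (M : zmodType).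
Local Notation A := (grpalg k M).

HB.instance Definition _ := GRing.Zmodule.copy (grpalg k M) {malg k[M]}.

Definition ga_one : A := << 1 *g (0 : M) >>.
Definition ga_mul (f g : A) : A :=
  \sum_(u <- msupp f) \sum_(v <- msupp g) << f@_u * g@_v *g (u + v)%R >>.

Lemma ga_mulw (d1 d2 : {fset M}) (f g : A) :
  msupp f `<=` d1 -> msupp g `<=` d2 ->
  ga_mul f g = \sum_(u <- d1) \sum_(v <- d2) << f@_u * g@_v *g (u + v)%R >>.
Proof.
move=> le1 le2; rewrite /ga_mul (big_fset_incl _ le1) /=; last first.
  move=> u _ /mcoeff_outdom fu.
  by rewrite big1 // => v _; rewrite fu mul0r monalgU0.
apply/eq_bigr=> u _; apply/big_fset_incl => // v _ /mcoeff_outdom ->.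
by rewrite mulr0 monalgU0.
Qed.

Lemma ga_mulC : commutative ga_mul.
Proof.
move=> f g; rewrite /ga_mul exchange_big /=.
by apply/eq_bigr=> v _; apply/eq_bigr=> u _; rewrite mulrC addrC.
Qed.

Lemma ga_mulDl : left_distributive ga_mul +%R.
Proof.
move=> f1 f2 g.
rewrite (ga_mulw (msuppD_le f1 f2) (fsubset_refl (msupp g))).
rewrite (ga_mulw (fsubsetUl (msupp f1) (msupp f2)) (fsubset_refl (msupp g))).
rewrite (ga_mulw (fsubsetUr (msupp f1) (msupp f2)) (fsubset_refl (msupp g))).
rewrite -big_split /=; apply/eq_bigr=> u _.
rewrite -big_split /=; apply/eq_bigr=> v _.
by rewrite mcoeffD mulrDl monalgUD.
Qed.

Lemma ga_mul0 : left_zero 0 ga_mul.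
Proof. by move=> g; rewrite /ga_mul msupp0 big_seq_fset0. Qed.

Lemma ga_mulUU a b (u v : M) :
  ga_mul << a *g u >> << b *g v >> = << a * b *g (u + v)%R >>.
Proof. by rewrite (ga_mulw msuppU_le msuppU_le) !big_seq_fset1 !mcoeffUU. Qed.

Lemma ga_mul_suml I (s : seq I) (F : I -> A) g :
  ga_mul (\sum_(i <- s) F i) g = \sum_(i <- s) ga_mul (F i) g.
Proof. exact: (big_morph (ga_mul^~ g) (fun _ _ => ga_mulDl _ _ _) (ga_mul0 g)). Qed.

Lemma ga_mul_sumr I (s : seq I) (F : I -> A) g :
  ga_mul g (\sum_(i <- s) F i) = \sum_(i <- s) ga_mul g (F i).
Proof.
by rewrite ga_mulC ga_mul_suml; apply/eq_bigr=> i _; rewrite ga_mulC.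
Qed.

Lemma ga_mul1 : left_id ga_one ga_mul.
Proof.
move=> g; rewrite {1}(monalgE g) ga_mul_sumr [RHS]monalgE.
by apply/eq_bigr=> v _; rewrite ga_mulUU mul1r add0r.
Qed.

Lemma ga_mulA : associative ga_mul.
Proof.
move=> f g h; rewrite (monalgE f) (monalgE g) (monalgE h).
rewrite [LHS]ga_mul_suml [X in _ = ga_mul X _]ga_mul_suml [RHS]ga_mul_suml.
apply/eq_bigr=> u _; rewrite [X in ga_mul _ X = _]ga_mul_suml.
rewrite [X in _ = ga_mul X _]ga_mul_sumr [LHS]ga_mul_sumr [RHS]ga_mul_suml.
apply/eq_bigr=> v _.
rewrite [X in ga_mul _ X = _]ga_mul_sumr [LHS]ga_mul_sumr [RHS]ga_mul_sumr.
by apply/eq_bigr=> t _; rewrite !ga_mulUU mulrA addrA.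
Qed.

Lemma ga_one_neq0 : ga_one != 0.
Proof.
by apply/eqP/malgP => /(_ 0) /eqP; rewrite mcoeffUU mcoeff0 oner_eq0.
Qed.

HB.instance Definition _ := GRing.Zmodule_isComNzRing.Build (grpalg k M)
  ga_mulA ga_mulC ga_mul1 ga_mulDl ga_one_neq0.

Definition ga_const (c : k) : A := << c *g (0 : M) >>.

Lemma ga_const_additive : additive ga_const.
Proof. by move=> a b; rewrite /ga_const monalgUB. Qed.

Lemma ga_const_multiplicative : multiplicative ga_const.
Proof. by split=> // a b; rewrite /ga_const [RHS]ga_mulUU addr0. Qed.

HB.instance Definition _ :=
  GRing.isAdditive.Build k (grpalg k M) ga_const ga_const_additive.
HB.instance Definition _ :=
  GRing.isMultiplicative.Build k (grpalg k M) ga_const ga_const_multiplicative.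

End GroupAlgebra.

Section GroupAlgebraMap.
Variables (k : comNzRingType) (M N : zmodType) (h : {additive M -> N}).

Definition ga_map (g : grpalg k M) : grpalg k N :=
  \sum_(u <- msupp g) << g@_u *g h u >>.

Lemma ga_mapw (d : {fset M}) (g : grpalg k M) : msupp g `<=` d ->
  ga_map g = \sum_(u <- d) << g@_u *g h u >>.
Proof.
move=> le; rewrite /ga_map (big_fset_incl _ le) //= => u _ /mcoeff_outdom ->.
by rewrite monalgU0.
Qed.

Lemma ga_mapU c u : ga_map << c *g u >> = << c *g h u >>.
Proof. by rewrite (ga_mapw msuppU_le) big_seq_fset1 mcoeffUU. Qed.

Lemma ga_map_additive : additive ga_map.
Proof.
move=> f g; have lef : msupp f `<=` msupp f `|` msupp g by exact: fsubsetUl.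
have leg : msupp g `<=` msupp f `|` msupp g by exact: fsubsetUr.
rewrite (ga_mapw (msuppB_le f g)) (ga_mapw lef) (ga_mapw leg) -sumrB.
by apply/eq_bigr=> u _; rewrite mcoeffB monalgUB.
Qed.

HB.instance Definition _ :=
  GRing.isAdditive.Build (grpalg k M) (grpalg k N) ga_map ga_map_additive.

Lemma ga_map_multiplicative : multiplicative ga_map.
Proof.
split=> [f g|]; last by rewrite ga_mapU raddf0.
rewrite [LHS]raddf_sum; under eq_bigr do rewrite raddf_sum /=.
rewrite [in RHS]/ga_map [RHS]mulr_suml.
apply/eq_bigr=> u _; rewrite [RHS]mulr_sumr; apply/eq_bigr=> v _.
by rewrite [RHS]ga_mulUU ga_mapU raddfD.
Qed.

HB.instance Definition _ :=
  GRing.isMultiplicative.Build (grpalg k M) (grpalg k N) ga_map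
    ga_map_multiplicative.

End GroupAlgebraMap.

Record ideal (A : comPzRingType) := Ideal {
  in_ideal :> A -> Prop;
  ideal0 : in_ideal 0;
  idealD : forall a b, in_ideal a -> in_ideal b -> in_ideal (a + b);
  idealM : forall a b, in_ideal b -> in_ideal (a * b) }.

Section GeneratedIdeal.
Variables (A : comPzRingType) (G : A -> Prop).

Definition gen_mem (a : A) : Prop :=
  exists2 s : seq (A * A), (forall q, q \in s -> G q.2)
    & a = \sum_(q <- s) q.1 * q.2.

Lemma gen_mem0 : gen_mem 0.
Proof. by exists [::]; rewrite ?big_nil. Qed.

Lemma gen_memD a b : gen_mem a -> gen_mem b -> gen_mem (a + b).
Proof.
move=> [s sG ->] [t tG ->]; exists (s ++ t); last by rewrite big_cat.
by move=> q; rewrite mem_cat => /orP[/sG|/tG].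
Qed.

Lemma gen_memM a b : gen_mem b -> gen_mem (a * b).
Proof.
move=> [s sG ->]; exists [seq (a * q.1, q.2) | q <- s].
  by move=> _ /mapP[q qs ->]; apply: (sG q).
by rewrite big_map mulr_sumr; apply/eq_bigr=> q _; rewrite mulrA.
Qed.

Definition gen_ideal : ideal A := Ideal gen_mem0 gen_memD gen_memM.

Lemma gen_ideal_min (I : ideal A) :
  (forall a, G a -> I a) -> forall a, gen_ideal a -> I a.
Proof.
move=> GI _ [s sG ->]; rewrite big_seq; elim/big_ind: _ => [|a b|q /sG].
- exact: (ideal0 I).
- exact: (@idealD _ I).
- by move=> /GI; apply: (@idealM _ I).
Qed.

Lemma gen_ideal_gen a : G a -> gen_ideal a.
Proof.
move=> Ga; exists [:: (1, a)]; last by rewrite big_seq1 mul1r.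
by move=> q; rewrite inE => /eqP->.
Qed.

End GeneratedIdeal.

Section Quotient.
Local Open Scope quotient_scope.
Variables (A : comPzRingType) (I : ideal A).

Lemma idealN a : I a -> I (- a).
Proof. by move=> /(idealM (-1)); rewrite mulN1r. Qed.

Definition eq_mod (a b : A) : bool := `[< I (a - b) >].

Lemma eq_mod_equiv : equiv_class_of eq_mod.
Proof.
split=> [a|a b|b a c].
- by apply/asboolP; rewrite subrr; apply: ideal0.
- by apply/asboolP/asboolP => /idealN; rewrite opprB.
- move=> /asboolP Hab /asboolP Hbc; apply/asboolP.
  by rewrite -(subrKA b); apply: idealD.
Qed.

Canonical eq_mod_rel := EquivRelPack eq_mod_equiv.

(* The quotient A/I. It may be the zero ring, which mathcomp's ring_quotient
   excludes: strata and initial degenerations may be empty. *)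
Definition quot := {eq_quot eq_mod}.

HB.instance Definition _ : EqQuotient A eq_mod quot := EqQuotient.on quot.
HB.instance Definition _ := Choice.on quot.

Lemma quot_eqP a b : reflect (\pi_quot a = \pi_quot b) `[< I (a - b) >].
Proof. exact: (@eqmodP _ eq_mod_rel a b). Qed.

Lemma repr_mod (a : A) : I (repr (\pi_quot a) - a).
Proof. by apply/asboolP/quot_eqP; rewrite reprK. Qed.

Definition quot_zero : quot := \pi_quot 0.
Definition quot_one : quot := \pi_quot 1.
Definition quot_opp (x : quot) : quot := \pi_quot (- repr x).
Definition quot_add (x y : quot) : quot := \pi_quot (repr x + repr y).
Definition quot_mul (x y : quot) : quot := \pi_quot (repr x * repr y).

Lemma pi_opp a : \pi_quot (- a) = quot_opp (\pi_quot a).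
Proof.
apply/esym/quot_eqP/asboolP; rewrite opprK addrC -opprB.
by apply/idealN/repr_mod.
Qed.

Lemma pi_add a b : \pi_quot (a + b) = quot_add (\pi_quot a) (\pi_quot b).
Proof.
apply/esym/quot_eqP/asboolP; rewrite opprD addrACA.
by apply: idealD; apply: repr_mod.
Qed.

Lemma pi_mul a b : \pi_quot (a * b) = quot_mul (\pi_quot a) (\pi_quot b).
Proof.
apply/esym/quot_eqP/asboolP; set a' := repr _; set b' := repr _.
rewrite -[X in I X](subrKA (a * b')) -mulrBl -mulrBr.
by apply: idealD; [rewrite mulrC|]; apply: idealM; apply: repr_mod.
Qed.

Lemma quot_ind (P : quot -> Prop) : (forall a, P (\pi_quot a)) -> forall x, P x.
Proof. by move=> Ppi x; rewrite -[x]reprK. Qed.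

Lemma quot_addA : associative quot_add.
Proof.
by elim/quot_ind=> a; elim/quot_ind=> b; elim/quot_ind=> c;
  rewrite -!pi_add addrA.
Qed.

Lemma quot_addC : commutative quot_add.
Proof. by elim/quot_ind=> a; elim/quot_ind=> b; rewrite -!pi_add addrC. Qed.

Lemma quot_add0 : left_id quot_zero quot_add.
Proof. by elim/quot_ind=> a; rewrite -!pi_add add0r. Qed.

Lemma quot_addN : left_inverse quot_zero quot_opp quot_add.
Proof. by elim/quot_ind=> a; rewrite -pi_opp -!pi_add addNr. Qed.

HB.instance Definition _ :=
  GRing.isZmodule.Build quot quot_addA quot_addC quot_add0 quot_addN.

Lemma quot_mulA : associative quot_mul.
Proof.
by elim/quot_ind=> a; elim/quot_ind=> b; elim/quot_ind=> c;
  rewrite -!pi_mul mulrA.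
Qed.

Lemma quot_mulC : commutative quot_mul.
Proof. by elim/quot_ind=> a; elim/quot_ind=> b; rewrite -!pi_mul mulrC. Qed.

Lemma quot_mul1 : left_id quot_one quot_mul.
Proof. by elim/quot_ind=> a; rewrite -!pi_mul mul1r. Qed.

Lemma quot_mulDl : left_distributive quot_mul +%R.
Proof.
elim/quot_ind=> a; elim/quot_ind=> b; elim/quot_ind=> c.
by rewrite -[_ + _]pi_add -!pi_mul -[RHS]pi_add mulrDl.
Qed.

HB.instance Definition _ := GRing.Zmodule_isComPzRing.Build quot
  quot_mulA quot_mulC quot_mul1 quot_mulDl.

Definition quot_pi (a : A) : quot := \pi_quot a.

Lemma quot_pi_ind (P : quot -> Prop) :
  (forall a, P (quot_pi a)) -> forall x, P x.
Proof. exact: quot_ind. Qed.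

Lemma quot_piP a b : quot_pi a = quot_pi b <-> I (a - b).
Proof. by split=> [/quot_eqP/asboolP|/asboolP/quot_eqP]. Qed.

Lemma quot_pi_additive : additive quot_pi.
Proof. by move=> a b; rewrite /quot_pi pi_add pi_opp. Qed.

Lemma quot_pi_multiplicative : multiplicative quot_pi.
Proof. by split=> // a b; apply: pi_mul. Qed.

HB.instance Definition _ :=
  GRing.isAdditive.Build A quot quot_pi quot_pi_additive.
HB.instance Definition _ :=
  GRing.isMultiplicative.Build A quot quot_pi quot_pi_multiplicative.

End Quotient.

Section QuotientMap.
Variables (A B : comPzRingType) (I : ideal A) (J : ideal B).
Variables (f : {rmorphism A -> B}) (fIJ : forall a, I a -> J (f a)).

Definition quot_map & (forall a, I a -> J (f a)) : quot I -> quot J :=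
  fun x => quot_pi J (f (repr x)).
Local Notation g := (quot_map fIJ).

Lemma quot_mapE a : g (quot_pi I a) = quot_pi J (f a).
Proof. by apply/quot_piP; rewrite -rmorphB; apply/fIJ/repr_mod. Qed.

Lemma quot_map_additive : additive g.
Proof.
elim/quot_pi_ind=> a; elim/quot_pi_ind=> b.
by rewrite -(rmorphB (quot_pi I)) !quot_mapE (rmorphB f) rmorphB.
Qed.

Lemma quot_map_multiplicative : multiplicative g.
Proof.
split; last by rewrite -(rmorph1 (quot_pi I)) quot_mapE (rmorph1 f) rmorph1.
elim/quot_pi_ind=> a; elim/quot_pi_ind=> b.
by rewrite -(rmorphM (quot_pi I)) !quot_mapE (rmorphM f) rmorphM.
Qed.

HB.instance Definition _ :=
  GRing.isAdditive.Build (quot I) (quot J) g quot_map_additive.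
HB.instance Definition _ :=
  GRing.isMultiplicative.Build (quot I) (quot J) g quot_map_multiplicative.

End QuotientMap.

(* Affine k-schemes Spec A, presented as the opposite category of commutative
   k-algebras (the zero algebra being the empty scheme). *)
Record affSch (k : comNzRingType) := Spec {
  coord_ring : comPzRingType;
  coord_ring_str : {rmorphism k -> coord_ring} }.

Record scheme_hom (k : comNzRingType) (X Y : affSch k) := SchemeHom {
  pull : {rmorphism coord_ring Y -> coord_ring X};
  pull_str : forall c, pull (coord_ring_str Y c) = coord_ring_str X c }.

(* A morphism of affine schemes Spec B -> Spec A is a closed immersion iff
   A -> B is surjective. *)
Definition closed_immersion (k : comNzRingType) (X Y : affSch k)
  (f : scheme_hom X Y) : Prop :=
  forall b : coord_ring X, exists a : coord_ring Y, pull f a = b.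

(* X -> Y -> Z, as an equation between morphisms X -> Z. *)
Definition factors (k : comNzRingType) (X Y Z : affSch k)
    (h : scheme_hom X Z) (f : scheme_hom X Y) (g : scheme_hom Y Z) : Prop :=
  forall a : coord_ring Z, pull h a = pull f (pull g a).

Section Limit.
Variables (k : comNzRingType) (J : Type) (le : J -> J -> Prop).
Variables (D : J -> affSch k) (D_map : forall i j, le i j -> scheme_hom (D j) (D i)).

Record cone := Cone {
  apex : affSch k;
  proj : forall j, scheme_hom apex (D j);
  proj_comm : forall i j (ij : le i j), factors (proj i) (proj j) (D_map ij) }.

Definition is_limit (L : cone) : Prop :=
  forall K : cone, exists f : scheme_hom (apex K) (apex L),
    (forall j, factors (proj K j) f (proj L j)) /\
    (forall g : scheme_hom (apex K) (apex L),
       (forall j, factors (proj K j) g (proj L j)) -> pull g =1 pull f).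

End Limit.

Section Torus.
Variables (k : comNzRingType) (M : zmodType).

(* The closed subscheme V(I) of the torus with character lattice M. *)
Definition torus_subscheme (I : ideal (grpalg k M)) : affSch k :=
  @Spec k (quot I) (quot_pi I \o @ga_const k M).

Variables (R : realDomainType) (w : {additive M -> R}).

Definition initial_form (f : grpalg k M) : grpalg k M :=
  \sum_(u <- msupp f | all (fun v => w u <= w v) (msupp f)) << f@_u *g u >>.

Definition initial_ideal (I : ideal (grpalg k M)) : ideal (grpalg k M) :=
  gen_ideal (fun h => exists2 f, I f & h = initial_form f).

(* The cocharacter w lies in the tropicalization of V(I). *)
Definition trop (I : ideal (grpalg k M)) : Prop := ~ initial_ideal I 1.

Definition initial_degeneration (I : ideal (grpalg k M)) : affSch k :=
  torus_subscheme (initial_ideal I).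

End Torus.

(* The index set of the Pluecker coordinates of Fl(r, n): the disjoint union
   over j of the sets binom([n], r_j). A sequence (Q_1, ..., Q_s) with
   Q_j a subset of binom([n], r_j) is encoded by the subset of
   [plucker_index n r] which is the disjoint union of the Q_j. *)
Definition plucker_index (n s : nat) (r : 'I_s -> nat) : Type :=
  {x : 'I_s * {set 'I_n} | #|x.2| == r x.1}.

HB.instance Definition _ n s (r : 'I_s -> nat) := Finite.on (plucker_index n r).

Section Strata.
Variables (R : realType) (n s : nat) (r : 'I_s -> nat).
Local Notation C := (R[i]).
Local Notation coord := (plucker_index n r).

Definition pos (x : coord) : 'I_s := (val x).1.
Definition sub (x : coord) : {set 'I_n} := (val x).2.

Section CharacterLattice.
Variable Q : {set coord}.

(* The character lattice of T(Q_1) x ... x T(Q_s), dual to the product of the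
   N(Q_j) = Z^{Q_j} / Z(1,...,1). *)
Definition char_pred : {pred {ffun coord -> int}} :=
  [pred u : {ffun coord -> int} | [forall x, (x \notin Q) ==> (u x == 0)]
            && [forall j, \sum_(x | pos x == j) u x == 0]].

Lemma char_predP (u : {ffun coord -> int}) :
  reflect ((forall x, x \notin Q -> u x = 0) /\
           (forall j, \sum_(x | pos x == j) u x = 0)) (u \in char_pred).
Proof.
apply: (iffP andP) => -[h1 h2]; split.
- by move=> x xQ; apply/eqP; move/forallP/(_ x)/implyP: h1; apply.
- by move=> j; apply/eqP; move/forallP: h2; apply.
- by apply/forallP=> x; apply/implyP=> /h1 ->.
- by apply/forallP=> j; rewrite h2.
Qed.

Lemma char_pred_zmod : zmod_closed char_pred.
Proof.
split=> [|u v /char_predP[u1 u2] /char_predP[v1 v2]]; apply/char_predP; split.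
- by move=> x _; rewrite ffunE.
- by move=> j; rewrite big1 // => x _; rewrite ffunE.
- by move=> x xQ; rewrite !ffunE u1 ?v1.
- move=> j; under eq_bigr do rewrite !ffunE.
  by rewrite big_split sumrN /= u2 v2 subr0.
Qed.

HB.instance Definition _ :=
  GRing.isZmodClosed.Build {ffun coord -> int} char_pred char_pred_zmod.

Record char_lattice := CharLattice {
  char_val :> {ffun coord -> int};
  char_valP : char_val \in char_pred }.

HB.instance Definition _ := [isSub for char_val].
HB.instance Definition _ := [Choice of char_lattice by <:].
HB.instance Definition _ := [SubChoice_isSubZmodule of char_lattice by <:].

(* A vector of the product of the R^{Q_j} as a real cocharacter. *)
Definition pairing (w : coord -> R) (u : char_lattice) : R :=
  \sum_x (u x)%:~R * w x.

Lemma pairing_additive w : additive (pairing w).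
Proof.
move=> u v; rewrite /pairing -sumrB; apply/eq_bigr=> x _.
by rewrite -[char_val (u - v)]/(val (u - v)) raddfB !ffunE rmorphB mulrBl.
Qed.

HB.instance Definition _ w :=
  GRing.isAdditive.Build char_lattice R (pairing w) (pairing_additive w).

End CharacterLattice.

(* The rows of F j form a basis of the subspace F_j of C^n. *)
Definition is_flag (F : forall j : 'I_s, 'M[C]_(r j, n)) : Prop :=
  (forall j, row_free (F j)) /\
  (forall i j : 'I_s, (i <= j)%N -> (F i <= F j)%MS).

(* The b-th element of [sub x], in increasing order. *)
Definition column (x : coord) (b : 'I_(r (pos x))) : 'I_n :=
  enum_val (cast_ord (esym (eqP (valP x))) b).

Definition plucker (F : forall j : 'I_s, 'M[C]_(r j, n)) (x : coord) : C :=
  \det (colsub (@column x) (F (pos x))).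

(* Polynomials in the Pluecker coordinates p_x. *)
Local Notation plucker_poly := {malg C[{cmonom coord}]}.
Implicit Types (g : plucker_poly) (a m : {cmonom coord}).

Definition eval (p : coord -> C) g : C :=
  mmap idfun (fun a => \prod_x p x ^+ a x) g.

(* For multihomogeneous g: membership in the ideal of Fl(r, n). *)
Definition vanishes_on_flags g : Prop :=
  forall F, is_flag F -> eval (plucker F) g = 0.

Definition multideg a (j : 'I_s) : nat := (\sum_(x | pos x == j) a x)%N.

Definition supported (Q : {set coord}) a : bool :=
  [forall x, (a x != 0%N) ==> (x \in Q)].

(* The character p^a / p^m; only used for a and m supported in Q and of the same
   multidegree, where a - m belongs to the character lattice. *)
Definition exp_diff (Q : {set coord}) a m : char_lattice Q :=
  insubd 0 [ffun x => (a x)%:Z - (m x)%:Z].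

(* Set p_x = 0 in g for x not in Q, then divide by the monomial p^m. *)
Definition dehomogenize (Q : {set coord}) m g : grpalg C (char_lattice Q) :=
  \sum_(a <- msupp g | supported Q a) << g@_a *g exp_diff Q a m >>.

(* Local equations of Fl(r, n) on T(Q_1) x ... x T(Q_s): the restrictions of
   the multihomogeneous polynomials g vanishing on Fl(r, n), divided by a
   monomial of the same multidegree. Together they cut out the scheme-theoretic
   intersection. *)
Definition stratum_gen (Q : {set coord}) (f : grpalg C (char_lattice Q)) : Prop :=
  exists g m, [/\ vanishes_on_flags g, supported Q m,
    forall a, a \in msupp g -> multideg a =1 multideg m
    & f = dehomogenize Q m g].

Definition stratum_ideal (Q : {set coord}) : ideal (grpalg C (char_lattice Q)) :=
  gen_ideal (@stratum_gen Q).

Definition stratum (Q : {set coord}) : affSch C :=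
  torus_subscheme (stratum_ideal Q).

Definition height (v : 'I_n -> R) (w : coord -> R) (x : coord) : R :=
  \sum_(i in sub x) v i + w x.

(* The tuple of the (Q_j)^{w_j}_v. *)
Definition cell (Q : {set coord}) (w : coord -> R) (v : 'I_n -> R) : {set coord} :=
  [set x in Q | [forall (y | (y \in Q) && (pos y == pos x)),
                   height v w x <= height v w y]].

(* The order P <= Q on flag matroids. *)
Definition face (P Q : {set coord}) : Prop :=
  exists v, P = cell Q (fun=> 0) v.

Lemma cell_sub Q w v : cell Q w v \subset Q.
Proof. by apply/subsetP=> x; rewrite inE => /andP[]. Qed.

Lemma face_sub P Q : face P Q -> P \subset Q.
Proof. by move=> [v ->]; apply: cell_sub. Qed.

Section Inclusion.
Variables (P Q : {set coord}) (PQ : P \subset Q).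

Lemma char_incl_subproof (u : char_lattice P) : char_val u \in char_pred Q.
Proof.
case: u => u /= /char_predP[u1 u2]; apply/char_predP; split=> // x xQ.
by apply: u1; apply: contra xQ; apply/subsetP.
Qed.

Definition char_incl : char_lattice P -> char_lattice Q :=
  fun u => CharLattice (char_incl_subproof u).
Local Notation incl := char_incl.

Lemma char_incl_additive : additive incl.
Proof.
move=> u v; apply: val_inj; rewrite [RHS]raddfB.
exact: (raddfB (val : char_lattice P -> _)).
Qed.

HB.instance Definition _ := GRing.isAdditive.Build (char_lattice P)
  (char_lattice Q) incl char_incl_additive.

Lemma char_incl_diff a m : multideg a =1 multideg m ->
  supported P a -> supported P m ->
  incl (exp_diff P a m) = exp_diff Q a m.
Proof.
move=> dam /forallP sa /forallP sm; apply: val_inj => /=.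
have hP (S : {set coord}) : P \subset S ->
    [ffun x => (a x)%:Z - (m x)%:Z] \in char_pred S.
  move=> PS; apply/char_predP; split=> [x xS|j].
    have xP : x \notin P by apply: contra xS; apply/subsetP.
    have := sa x; have := sm x; rewrite (negbTE xP) !implybF !negbK ffunE.
    by move=> /eqP-> /eqP->; rewrite subrr.
  under eq_bigr do rewrite ffunE.
  rewrite sumrB -!(big_morph Posz PoszD (erefl 0%:Z)).
  by move: (dam j); rewrite /multideg => ->; rewrite subrr.
by rewrite -[char_val _]/(val (exp_diff P a m)) !insubdK ?hP.
Qed.

End Inclusion.

(* Stability of Fl(r, n) under the torus of diagonal matrices: the homogeneous
   components, for the Z^n-grading where p_x has degree the indicator of
   [sub x], of a polynomial vanishing on Fl(r, n) vanish on Fl(r, n). *)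
Section TorusWeights.

Definition weight a (i : 'I_n) : nat := (\sum_(x | i \in sub x) a x)%N.

Lemma pow_sum_eq0 (T : choiceType) (X : seq T) (z : T -> C) (e : T -> nat) :
  (forall q, q != 0 -> \sum_(a <- X) z a * q ^+ e a = 0) ->
  forall c, \sum_(a <- X | e a == c) z a = 0.
Proof.
move=> h c; pose p : {poly C} := \sum_(a <- X) z a *: 'X^(e a).
have pE q : p.[q] = \sum_(a <- X) z a * q ^+ e a.
  by rewrite horner_sum; apply/eq_bigr=> a _; rewrite !hornerE.
have p0 : p = 0.
  apply/eqP/negP=> /negP p0.
  pose l := [seq (i.+1)%:R : C | i <- iota 0 (size p)].
  have us : uniq l by rewrite map_inj_uniq ?iota_uniq // => i j /eqP; rewrite eqr_nat => /eqP[].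
  have rs : all (root p) l.
    by apply/allP=> _ /mapP[i _ ->]; rewrite rootE pE h // pnatr_eq0.
  by have := max_poly_roots p0 rs us; rewrite size_map size_iota ltnn.
rewrite -[RHS](coef0 C c) -p0 coef_sum [LHS]big_mkcond.
apply/eq_bigr=> a _; rewrite coefZ coefXn eq_sym.
by case: eqP => _; rewrite ?mulr1 ?mulr0.
Qed.

Definition scale_flag (t : 'I_n -> C) (F : forall j : 'I_s, 'M[C]_(r j, n)) :
  forall j : 'I_s, 'M[C]_(r j, n) := fun j => F j *m diag_mx (\row_i t i).

Lemma scale_is_flag t F : (forall i, t i != 0) -> is_flag F ->
  is_flag (scale_flag t F).
Proof.
move=> t0 [Ff Fle]; split=> [j|i j ij]; last by rewrite submxMr ?Fle.
rewrite /row_free mxrankMfree; first exact: Ff.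
rewrite row_free_unit unitmxE det_diag unitfE prodf_seq_neq0.
by apply/allP=> i _; rewrite mxE t0.
Qed.

Lemma plucker_scale t F x :
  plucker (scale_flag t F) x = \prod_(i in sub x) t i * plucker F x.
Proof.
rewrite /plucker; set f := @column x.
have -> : colsub f (scale_flag t F (pos x)) =
    colsub f (F (pos x)) *m diag_mx (\row_b t (f b)).
  by apply/matrixP=> b c; rewrite /scale_flag !mul_mx_diag !mxE.
rewrite det_mulmx det_diag mulrC; congr (_ * _).
under eq_bigr do rewrite mxE /f /column.
rewrite [RHS]big_enum_val.
rewrite [RHS](reindex (cast_ord (esym (eqP (valP x))))) //.
by exists (cast_ord (eqP (valP x))) => b _; apply: val_inj.
Qed.

End TorusWeights.
Lemma sum_classes_eq0 (T : choiceType) (U : eqType) (X : seq T) (f : T -> U)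
    (z : T -> C) :
  (forall c, \sum_(e <- X | f e == c) z e = 0) ->
  forall phi : U -> bool, \sum_(e <- X | phi (f e)) z e = 0.
Proof.
move=> h phi; transitivity
  (\sum_(c <- undup [seq f e | e <- X] | phi c) \sum_(e <- X | f e == c) z e).
  rewrite (exchange_big_dep (fun e => phi (f e))) /=; last by move=> c e ? /eqP->.
  rewrite big_seq_cond [RHS]big_seq_cond; apply/eq_bigr => e /andP[eX phie].
  rewrite (eq_bigl (pred1 (f e))) => [|c].
    rewrite -big_filter filter_pred1_uniq ?undup_uniq ?big_seq1 //.
    by rewrite mem_undup map_f.
  by rewrite /= [RHS]eq_sym; case: eqP => [<-|]; rewrite ?phie ?andbF.
by rewrite big1 // => c _; apply: h.
Qed.

Section HomogeneousParts.
Variables (g : plucker_poly) (gV : vanishes_on_flags g).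

Let term F a := g@_a * \prod_x plucker F x ^+ a x.

Let term_scale F a i q :
  term (scale_flag (fun l => if l == i then q else 1) F) a =
  term F a * q ^+ weight a i.
Proof.
rewrite /term -mulrA; congr (_ * _).
under eq_bigr do rewrite plucker_scale exprMn mulrC.
rewrite big_split /=; congr (_ * _).
rewrite /weight [in RHS]big_mkcond expr_sum; apply/eq_bigr=> x _.
case: ifP => ix; last first.
  by rewrite big1 ?expr1n // => l lx; case: eqP => // li; rewrite -li lx in ix.
rewrite (bigD1 i) //= eqxx big1 ?mulr1 // => l /andP[_ /negbTE-> //].
Qed.

Lemma weight_part_eq0 F (l : seq 'I_n) (c : 'I_n -> nat) : is_flag F ->
  \sum_(a <- msupp g | all (fun i => weight a i == c i) l) term F a = 0.
Proof.
elim: l F => [|i l IHl] F Fflag /=; first exact: gV.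
rewrite big_mkcondr /=; apply: pow_sum_eq0 => q q0.
rewrite -[RHS](IHl (scale_flag (fun l => if l == i then q else 1) F)).
  rewrite [RHS]big_mkcond; apply/eq_bigr=> a _.
  by rewrite term_scale; case: ifP => _; rewrite ?mul0r.
by apply: scale_is_flag => // j; case: ifP => // _; apply: oner_neq0.
Qed.

Lemma weight_filter_eq0 F (phi : {ffun 'I_n -> nat} -> bool) : is_flag F ->
  \sum_(a <- msupp g | phi [ffun i => weight a i]) term F a = 0.
Proof.
move=> Fflag; apply: (sum_classes_eq0 (f := fun a => [ffun i => weight a i])) => c.
rewrite -[RHS](weight_part_eq0 (enum 'I_n) c Fflag); apply/eq_bigl=> a.
have -> : all (fun i => weight a i == c i) (enum 'I_n) =
          ([ffun i => weight a i] == c).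
  apply/allP/eqP => [h|<- i _]; last by rewrite ffunE.
  by apply/ffunP=> i; rewrite ffunE; apply/eqP/h; rewrite mem_enum.
by [].
Qed.

Definition filter_poly (phi : {ffun 'I_n -> nat} -> bool) : plucker_poly :=
  [malg a in msupp g => if phi [ffun i => weight a i] then g@_a else 0].

Lemma filter_polyE phi a :
  (filter_poly phi)@_a = if phi [ffun i => weight a i] then g@_a else 0.
Proof. by rewrite mcoeffE; case: msuppP => //; rewrite if_same. Qed.

Lemma filter_poly_supp phi : msupp (filter_poly phi) `<=` msupp g.
Proof.
apply/fsubsetP=> a; rewrite -!mcoeff_neq0 filter_polyE.
by case: ifP => //; rewrite eqxx.
Qed.

Lemma filter_poly_vanishes phi : vanishes_on_flags (filter_poly phi).
Proof.
move=> F Fflag; rewrite /eval /mmap (big_fset_incl _ (filter_poly_supp phi)) /=.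
  rewrite -[RHS](weight_filter_eq0 phi Fflag) [RHS]big_mkcond.
  by apply/eq_bigr=> a _; rewrite filter_polyE; case: ifP; rewrite ?mul0r.
by move=> a _ /mcoeff_outdom ->; rewrite mul0r.
Qed.

End HomogeneousParts.

Section FaceMorphism.
Variables (P Q : {set coord}) (PQ : face P Q).

Lemma dehomogenizew S m g (d : {fset {cmonom coord}}) : msupp g `<=` d ->
  dehomogenize S m g =
  \sum_(a <- d) (if supported S a then << g@_a *g exp_diff S a m >> else 0).
Proof.
move=> le; rewrite /dehomogenize big_mkcond (big_fset_incl _ le) //=.
by move=> a _ /mcoeff_outdom ->; rewrite monalgU0 if_same.
Qed.

Lemma face_supportedP : exists phi : 'I_n -> R, forall a m,
  supported P m -> supported Q a -> multideg a =1 multideg m ->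
  (\sum_i (weight a i)%:R * phi i == \sum_i (weight m i)%:R * phi i)
    = supported P a.
Proof.
have [v PE] := PQ; exists v => a m sm sa dam.
pose ht x : R := \sum_(i in sub x) v i.
have wE b : \sum_i (weight b i)%:R * v i = \sum_x (b x)%:R * ht x.
  under eq_bigr do rewrite natr_sum mulr_suml.
  rewrite (exchange_big_dep predT) //=; apply/eq_bigr=> x _.
  by rewrite mulr_sumr.
pose h j : R := if [pick y in P | pos y == j] is Some y then ht y else 0.
have hle x y : x \in Q -> y \in P -> pos y = pos x -> ht y <= ht x.
  move=> xQ; rewrite PE inE /height => /andP[_ /forallP/(_ x)] + yx.
  by rewrite xQ yx eqxx /= !addr0.
have hE x : x \in P -> ht x = h (pos x).
  move=> xP; rewrite /h; case: pickP => [y /andP[yP /eqP yx]|/(_ x)]; last first.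
    by rewrite xP eqxx.
  have sPQ := subsetP (face_sub PQ).
  by apply/le_anti; rewrite !hle ?sPQ.
have hP x : x \in Q -> ht x = h (pos x) -> (exists2 y, y \in P & pos y = pos x) ->
    x \in P.
  move=> xQ hx [y0 y0P y0x]; rewrite PE inE xQ /=; apply/forallP=> y.
  apply/implyP=> /andP[yQ /eqP yx]; rewrite /height !addr0 -!/(ht _) hx.
  by rewrite -y0x -(hE _ y0P) hle // y0x.
have sumP (b : {cmonom coord}) : supported P b ->
    \sum_x (b x)%:R * ht x = \sum_x (b x)%:R * h (pos x).
  move=> /forallP sb; apply/eq_bigr=> x _.
  by move: (sb x); case: eqP => [->|_ /= /hE->//]; rewrite !mul0r.
have sum_h (b : {cmonom coord}) : \sum_x (b x)%:R * h (pos x) = \sum_j (multideg b j)%:R * h j.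
  rewrite (partition_big pos predT) //=; apply/eq_bigr=> j _.
  by rewrite natr_sum mulr_suml; apply/eq_bigr=> x /eqP ->.
have inP x : a x != 0%N -> exists2 y, y \in P & pos y = pos x.
  move=> ax; have : multideg m (pos x) != 0%N.
    by rewrite -dam /multideg (bigD1 x) //= addn_eq0 negb_and ax.
  rewrite sum_nat_eq0 => /forall_inPn[y /eqP yx my].
  by exists y => //; move/forallP/(_ y): sm; rewrite my.
rewrite !wE (sumP m) // sum_h -(eq_bigr _ (fun j _ => congr1 (fun d => d%:R * h j) (dam j))).
rewrite -sum_h; apply/eqP/idP => [|/sumP //].
move/eqP; rewrite -subr_eq0 -sumrB => /eqP.
have ge0 x : true -> 0 <= (a x)%:R * ht x - (a x)%:R * h (pos x).
  move=> _; rewrite -mulrBr; have [->|ax] := eqVneq (a x) 0%N.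
    by rewrite mul0r.
  rewrite mulr_ge0 // subr_ge0; have [y yP yx] := inP x ax.
  rewrite -yx -hE // hle //; by move/forallP/(_ x): sa; rewrite ax.
move=> /(psumr_eq0P ge0) h0; apply/forallP=> x; apply/implyP=> ax.
apply: hP; [by move/forallP/(_ x): sa; rewrite ax| |exact: inP].
have := h0 x isT; rewrite -mulrBr => /eqP; rewrite mulf_eq0 pnatr_eq0.
by rewrite (negbTE ax) subr_eq0 => /eqP.
Qed.

Lemma face_ideal f : stratum_ideal P f ->
  stratum_ideal Q (ga_map (char_incl (face_sub PQ)) f).
Proof.
have [v vP] := face_supportedP.
move=> [l lG ->]; rewrite rmorph_sum big_seq.
elim/big_ind: _ => [|b c|q /lG] /=; [exact: (ideal0 (stratum_ideal Q))|exact: (@idealD _ (stratum_ideal Q))|].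
rewrite rmorphM => -[g [m [gV sm dg ->]]]; apply: (@idealM _ (stratum_ideal Q)).
pose W (c : {ffun 'I_n -> nat}) : R := \sum_i (c i)%:R * v i.
pose g' := filter_poly g (fun c => W c == W [ffun i => weight m i]).
have sg' := filter_poly_supp g (fun c => W c == W [ffun i => weight m i]).
apply: gen_ideal_gen; exists g', m; split.
- exact: filter_poly_vanishes.
- apply/forallP=> x; apply/implyP=> mx; apply: (subsetP (face_sub PQ)).
  by move/forallP/(_ x): sm; rewrite mx.
- by move=> a /(fsubsetP sg'); apply: dg.
rewrite (dehomogenizew _ _ sg') (dehomogenizew _ _ (fsubset_refl _)) raddf_sum.
rewrite !big_seq; apply/eq_bigr=> a /dg da.
have WE b : W [ffun i => weight b i] = \sum_i (weight b i)%:R * v i.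
  by apply/eq_bigr=> i _; rewrite ffunE.
rewrite filter_polyE !WE; have [sQa|sQa] := boolP (supported Q a); last first.
  case: ifP => [sPa|_]; last by rewrite raddf0.
  case/negP: sQa; apply/forallP=> x; apply/implyP=> ax.
  by apply: (subsetP (face_sub PQ)); move/forallP/(_ x): sPa; rewrite ax.
rewrite (vP a m) //; case: ifP => sPa; last by rewrite raddf0 monalgU0.
rewrite [LHS]ga_mapU; congr mkmalgU; exact: char_incl_diff.
Qed.

End FaceMorphism.

Section FaceMorphismDef.
Variables (P Q : {set coord}) (PQ : face P Q).

Definition face_pull :
    {rmorphism coord_ring (stratum P) -> coord_ring (stratum Q)} :=
  quot_map (face_ideal PQ).

Lemma face_pull_str c :
  face_pull (coord_ring_str (stratum P) c) = coord_ring_str (stratum Q) c.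
Proof.
rewrite /face_pull /=; rewrite [LHS]quot_mapE; congr quot_pi.
by rewrite [LHS]ga_mapU raddf0.
Qed.

(* phi_{Q,P} : Fl(Q) -> Fl(P), given on coordinate rings by x^u |-> x^u. *)
Definition face_morphism : scheme_hom (stratum Q) (stratum P) := SchemeHom face_pull_str.

End FaceMorphismDef.

Definition uniform_flag : {set coord} := [set: coord].

(* The weight vector w represents a point of the product over j of the
   N(binom([n], r_j))_R. *)
Definition TFl (w : coord -> R) : Prop :=
  trop (pairing w) (stratum_ideal uniform_flag).

Definition in_Fl (w : coord -> R) : affSch C :=
  initial_degeneration (pairing w) (stratum_ideal uniform_flag).

Definition subdivision (w : coord -> R) : {set {set coord}} :=
  [set P | `[< exists v : 'I_n -> R, P = cell uniform_flag w v >] ].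

(* Cones over the diagram P |-> Fl(P), (P <= Q) |-> phi_{Q,P} indexed by the
   poset of the cells of the subdivision. *)
Definition subdivision_cone (w : coord -> R) : Type :=
  @cone C {P : {set coord} | P \in subdivision w}
    (fun P Q => face (val P) (val Q)) (fun P => stratum (val P))
    (fun P Q PQ => face_morphism PQ).

End Strata.

(* Main.v *)
Require Import Defs.
From HB Require Import structures.
From mathcomp Require Import all_boot all_order all_algebra.
From mathcomp Require Import finmap complex boolp reals.
From mathcomp Require Import monalg xfinmap.
From mathcomp Require Import lra.

Set Implicit Arguments.
Unset Strict Implicit.
Unset Printing Implicit Defensive.

Import Order.TTheory GRing.Theory Num.Theory.
Local Open Scope fset_scope.
Local Open Scope ring_scope.

(** On coordinate rings, the morphism from the initial degeneration to the
    stratum of a cell P of the subdivision is the inclusion x^u |-> x^u of the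
    Laurent polynomials on T(P) in those on the big torus. Two facts make the
    theorem work.

    The inclusion is well defined on the quotients ([cell_ideal]). Let P be cut
    out by v, so that its elements minimize the height
    h(x) = sum of the v_i for i in x, plus w_x, among the x of a given rank. An
    equation of the stratum of P comes from a multihomogeneous g vanishing on
    the flag variety, and keeps the monomials of g supported in P: those of least
    total height, as all have the same multidegree ([supported_leif]). Total
    height and w-weight differ by the degree of the monomial for the Z^n-grading
    evaluated at v. The flag variety is stable under the diagonal torus, so every
    graded piece g_t of g vanishes on it too; within g_t the two weights differ
    by a constant, and the monomials of g_t supported in P, if there are any,
    form the initial form of g_t. Summing over t puts the equation in the initial
    ideal.

    The morphism to the limit is a closed immersion
    ([in_Fl_cone_closed_immersion]). The image of the pullback is a subring
    containing the characters p_x / p_y for x and y in a common cell. Those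
    generate the character lattice as soon as any two x and y of the same rank
    are linked by a chain of indices in which neighbours share a cell. The cell
    of a suitable v contains x ([mem_own_cell]), likewise for y; passing from
    one vector to the other one coordinate at a time links x to y, since a move
    of v in a coordinate direction changes heights with only two speeds, and
    minimizers before and after it meet in a cell on the way ([cell_bump]).

    The limit exists because affine schemes have all limits
    ([limit_cone_is_limit]). *)

(** * Limits of affine schemes *)

Section AffineLimits.
Variables (k : comNzRingType) (J : Type) (le : J -> J -> Prop) (D : J -> affSch k).
Variable (D_map : forall i j, le i j -> scheme_hom (D j) (D i)).

(** The colimit of the coordinate rings is the ring of formal expressions in
    their elements, where two expressions are identified when they take the same
    value in every cone. The evaluations in cones are then jointly injective on
    the quotient ([value_inj]), so ring axioms and the universal property are
    read off from the cones, without a presentation by generators and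
    relations. *)
Inductive expr : Type :=
  | Gen (j : J) (a : coord_ring (D j))
  | Scalar (c : k)
  | Add (x y : expr)
  | Opp (x : expr)
  | Mul (x y : expr).

HB.instance Definition _ := gen_eqMixin expr.
HB.instance Definition _ := gen_choiceMixin expr.

Fixpoint interp (K : cone D_map) (x : expr) : coord_ring (apex K) :=
  match x with
  | Gen j a => pull (proj K j) a
  | Scalar c => coord_ring_str (apex K) c
  | Add x y => interp K x + interp K y
  | Opp x => - interp K x
  | Mul x y => interp K x * interp K y
  end.

Definition indist (x y : expr) : bool := `[< forall K, interp K x = interp K y >].

Lemma indist_equiv : equiv_class_of indist.
Proof.
split=> [x|x y|y x z]; first exact/asboolP.
- by apply/asboolP/asboolP => h K; rewrite h.
- by move=> /asboolP xy /asboolP yz; apply/asboolP=> K; rewrite xy.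
Qed.

Canonical indist_rel := EquivRelPack indist_equiv.

Definition colim := {eq_quot indist}%qT.

HB.instance Definition _ : EqQuotient expr indist colim := EqQuotient.on colim.
HB.instance Definition _ := Choice.on colim.

Definition classof (x : expr) : colim := (\pi_colim x)%qT.
Definition value (K : cone D_map) (x : colim) : coord_ring (apex K) :=
  interp K (repr x).

Lemma value_classof K x : value K (classof x) = interp K x.
Proof.
suff /asboolP : indist (repr (classof x)) x by apply.
by apply/(@eqmodP _ indist_rel); rewrite reprK.
Qed.

Lemma value_inj x y : (forall K, value K x = value K y) -> x = y.
Proof.
move=> h; rewrite -[x]reprK -[y]reprK.
by apply/(@eqmodP _ indist_rel)/asboolP.
Qed.

Definition colim_add (x y : colim) := classof (Add (repr x) (repr y)).
Definition colim_opp (x : colim) := classof (Opp (repr x)).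
Definition colim_mul (x y : colim) := classof (Mul (repr x) (repr y)).
Definition colim_scalar (c : k) := classof (Scalar c).

Lemma valueD K x y : value K (colim_add x y) = value K x + value K y.
Proof. exact: value_classof. Qed.

Lemma valueN K x : value K (colim_opp x) = - value K x.
Proof. exact: value_classof. Qed.

Lemma valueM K x y : value K (colim_mul x y) = value K x * value K y.
Proof. exact: value_classof. Qed.

Lemma value_scalar K c : value K (colim_scalar c) = coord_ring_str (apex K) c.
Proof. exact: value_classof. Qed.

Lemma value0 K : value K (colim_scalar 0) = 0.
Proof. by rewrite value_scalar rmorph0. Qed.

Lemma value1 K : value K (colim_scalar 1) = 1.
Proof. by rewrite value_scalar rmorph1. Qed.

Lemma colim_addA : associative colim_add.
Proof. by move=> x y z; apply: value_inj => K; rewrite !valueD addrA. Qed.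

Lemma colim_addC : commutative colim_add.
Proof. by move=> x y; apply: value_inj => K; rewrite !valueD addrC. Qed.

Lemma colim_add0 : left_id (colim_scalar 0) colim_add.
Proof. by move=> x; apply: value_inj => K; rewrite valueD value0 add0r. Qed.

Lemma colim_addN : left_inverse (colim_scalar 0) colim_opp colim_add.
Proof.
by move=> x; apply: value_inj => K; rewrite valueD valueN value0 addNr.
Qed.

HB.instance Definition _ :=
  GRing.isZmodule.Build colim colim_addA colim_addC colim_add0 colim_addN.

Lemma colim_mulA : associative colim_mul.
Proof. by move=> x y z; apply: value_inj => K; rewrite !valueM mulrA. Qed.

Lemma colim_mulC : commutative colim_mul.
Proof. by move=> x y; apply: value_inj => K; rewrite !valueM mulrC. Qed.

Lemma colim_mul1 : left_id (colim_scalar 1) colim_mul.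
Proof. by move=> x; apply: value_inj => K; rewrite valueM value1 mul1r. Qed.

Lemma colim_mulDl : left_distributive colim_mul colim_add.
Proof.
by move=> x y z; apply: value_inj => K; rewrite !(valueM, valueD) mulrDl.
Qed.

HB.instance Definition _ := GRing.Zmodule_isComPzRing.Build colim
  colim_mulA colim_mulC colim_mul1 colim_mulDl.

Lemma value_additive K : additive (value K).
Proof. by move=> x y; rewrite [LHS]valueD valueN. Qed.

Lemma value_multiplicative K : multiplicative (value K).
Proof. by split=> [x y|]; [apply: valueM|apply: value1]. Qed.

HB.instance Definition _ K := GRing.isAdditive.Build colim
  (coord_ring (apex K)) (value K) (value_additive K).
HB.instance Definition _ K := GRing.isMultiplicative.Build colim
  (coord_ring (apex K)) (value K) (value_multiplicative K).

Lemma colim_scalar_additive : additive colim_scalar.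
Proof.
move=> a b; apply: value_inj => K.
by rewrite value_additive !value_scalar rmorphB.
Qed.

Lemma colim_scalar_multiplicative : multiplicative colim_scalar.
Proof.
split=> // a b; apply: value_inj => K.
by rewrite (value_multiplicative K).1 !value_scalar rmorphM.
Qed.

HB.instance Definition _ := GRing.isAdditive.Build k colim
  colim_scalar colim_scalar_additive.
HB.instance Definition _ := GRing.isMultiplicative.Build k colim
  colim_scalar colim_scalar_multiplicative.

Definition limit_apex : affSch k := @Spec k colim colim_scalar.

Section Leg.
Variable j : J.

Definition leg (a : coord_ring (D j)) : colim := classof (Gen a).

Lemma value_leg K a : value K (leg a) = pull (proj K j) a.
Proof. exact: value_classof. Qed.

Lemma leg_additive : additive leg.
Proof.
move=> a b; apply: value_inj => K.
by rewrite value_additive !value_leg rmorphB.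
Qed.

Lemma leg_multiplicative : multiplicative leg.
Proof.
split=> [a b|]; apply: value_inj => K.
  by rewrite (value_multiplicative K).1 !value_leg rmorphM.
by rewrite (value_multiplicative K).2 !value_leg rmorph1.
Qed.

HB.instance Definition _ := GRing.isAdditive.Build (coord_ring (D j)) colim
  leg leg_additive.
HB.instance Definition _ := GRing.isMultiplicative.Build (coord_ring (D j))
  colim leg leg_multiplicative.

Lemma leg_str c : leg (coord_ring_str (D j) c) = colim_scalar c.
Proof.
by apply: value_inj => K; rewrite value_leg value_scalar pull_str.
Qed.

Definition limit_proj : scheme_hom limit_apex (D j) :=
  @SchemeHom k limit_apex (D j) leg leg_str.

End Leg.

Lemma limit_proj_comm i j (ij : le i j) :
  factors (limit_proj i) (limit_proj j) (D_map ij).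
Proof.
move=> a; apply: value_inj => K.
by rewrite [LHS]value_leg [RHS]value_leg (proj_comm K ij).
Qed.

Definition limit_cone : cone D_map := Cone limit_proj_comm.

Lemma limit_cone_is_limit : is_limit limit_cone.
Proof.
move=> K; exists (@SchemeHom k (apex K) limit_apex (value K) (value_scalar K)).
split=> [j a|g gK x]; first by rewrite /= value_leg.
(* A morphism of cones is determined on generators, hence on expressions. *)
have pg : forall y, pull g (classof y) = interp K y.
  elim=> [j a|c|y IHy z IHz|y IHy|y IHy z IHz] /=.
  - by rewrite (gK j a).
  - by rewrite -(pull_str g).
  - rewrite -IHy -IHz -rmorphD; congr (pull g _).
    by apply: value_inj => K'; rewrite value_classof [RHS]valueD !value_classof.
  - rewrite -IHy -rmorphN; congr (pull g _).
    by apply: value_inj => K'; rewrite value_classof [RHS]valueN !value_classof.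
  - rewrite -IHy -IHz -rmorphM; congr (pull g _).
    by apply: value_inj => K'; rewrite value_classof [RHS]valueM !value_classof.
by have := pg (repr x); rewrite /classof reprK.
Qed.

End AffineLimits.

(** * Initial forms of Laurent polynomials *)

Section InitialParts.
Variables (k : comNzRingType) (M : zmodType).

(** The terms of f whose exponent satisfies phi. Unlike the initial form, this
    is additive in f. *)
Definition part (phi : pred M) (f : grpalg k M) : grpalg k M :=
  \sum_(u <- msupp f | phi u) << f@_u *g u >>.

Lemma partw phi (d : {fset M}) (f : grpalg k M) : msupp f `<=` d ->
  part phi f = \sum_(u <- d) (if phi u then << f@_u *g u >> else 0).
Proof.
move=> le; rewrite /part big_mkcond (big_fset_incl _ le) //=.
by move=> u _ /mcoeff_outdom ->; rewrite monalgU0 if_same.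
Qed.

Lemma partU phi c u :
  part phi << c *g u >> = if phi u then << c *g u >> else 0.
Proof. by rewrite (partw _ msuppU_le) big_seq_fset1 mcoeffUU. Qed.

Lemma part_additive phi : additive (part phi).
Proof.
move=> f g; have lef : msupp f `<=` msupp f `|` msupp g by exact: fsubsetUl.
have leg : msupp g `<=` msupp f `|` msupp g by exact: fsubsetUr.
rewrite (partw _ (msuppB_le f g)) (partw _ lef) (partw _ leg) -sumrB.
apply/eq_bigr=> u _; case: ifP => _; last by rewrite subr0.
by rewrite mcoeffB monalgUB.
Qed.

HB.instance Definition _ phi :=
  GRing.isAdditive.Build (grpalg k M) (grpalg k M) (part phi) (part_additive phi).

Variables (R : realDomainType) (w : {additive M -> R}).

(** When c is a lower bound that no exponent of f attains, this part is zero;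
    otherwise it is the initial form. *)
Lemma part_initial (I : ideal (grpalg k M)) (c : R) f : I f ->
  (forall u, u \in msupp f -> c <= w u) ->
  initial_ideal w I (part (fun u => w u == c) f).
Proof.
move=> If cw.
have [/hasP[u0 u0f /eqP wu0]|/hasPn no] := boolP (has (fun u => w u == c) (msupp f)).
  apply: gen_ideal_gen; exists f => //; rewrite /part /initial_form.
  rewrite big_seq_cond [RHS]big_seq_cond; apply: eq_bigl => u.
  case uf: (u \in msupp f) => //=.
  apply/eqP/allP => [-> //|/(_ _ u0f)]; rewrite wu0 => wuc.
  by apply/le_anti; rewrite wuc cw.
rewrite /part big_seq_cond big1; first exact: (ideal0 (initial_ideal w I)).
move=> u /andP[uf wu].
by have := no _ uf; rewrite wu.
Qed.

End InitialParts.

(** * The strata of the cells and the initial degeneration *)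

Section Strata.
Variables (R : realType) (n s : nat) (r : 'I_s -> nat).
Local Notation C := (R[i]).
Local Notation coord := (plucker_index n r).
Implicit Types (P Q : {set coord}) (a m : {cmonom coord}) (x y z : coord).
Implicit Types (v : 'I_n -> R) (w : coord -> R).
Local Notation T := (uniform_flag n r).

Lemma exp_diffE Q a m : multideg a =1 multideg m ->
  supported Q a -> supported Q m ->
  char_val (exp_diff Q a m) = [ffun x => (a x)%:Z - (m x)%:Z].
Proof.
move=> dam /forallP sa /forallP sm; rewrite -[LHS]/(val _) insubdK //.
apply/char_predP; split=> [x xQ|j].
  have := sa x; have := sm x; rewrite (negbTE xQ) !implybF !negbK ffunE.
  by move=> /eqP-> /eqP->; rewrite subrr.
under eq_bigr do rewrite ffunE.
rewrite sumrB -!(big_morph Posz PoszD (erefl 0%:Z)).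
by move: (dam j); rewrite /multideg => ->; rewrite subrr.
Qed.

Lemma supported_uniform a : supported T a.
Proof. by apply/forallP=> x; rewrite inE implybT. Qed.

Lemma pairing_exp_diff w a m : multideg a =1 multideg m ->
  pairing w (exp_diff T a m) =
  \sum_x (a x)%:R * w x - \sum_x (m x)%:R * w x.
Proof.
move=> dam; rewrite /pairing -sumrB; apply/eq_bigr => x _.
by rewrite exp_diffE ?supported_uniform // ffunE rmorphB mulrBl.
Qed.

Lemma char_incl_trans (P Q S : {set coord}) (PQ : P \subset Q) (QS : Q \subset S)
  (PS : P \subset S) u : char_incl QS (char_incl PQ u) = char_incl PS u.
Proof. exact: val_inj. Qed.

Section Cell.
Variables (w : coord -> R) (v : 'I_n -> R).
Local Notation P := (cell T w v).

Lemma mem_cellP x :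
  reflect (forall y, pos y = pos x -> height v w x <= height v w y) (x \in P).
Proof.
rewrite inE in_setT /=; apply: (iffP forallP) => h y.
  by move=> yx; have := h y; rewrite in_setT yx eqxx.
by apply/implyP=> /andP[_ /eqP]; apply: h.
Qed.

Lemma cell_pos_neq0 x : exists2 y, y \in P & pos y = pos x.
Proof.
have [y /eqP yx ymin] :=
  @arg_minP _ _ _ x (fun y => pos y == pos x) (height v w) (eqxx _).
exists y => //; apply/mem_cellP => z zy; apply: ymin.
by rewrite zy yx.
Qed.

Lemma cell_level : exists h : 'I_s -> R, forall x,
  h (pos x) <= height v w x ?= iff (x \in P).
Proof.
(* The default 0 only concerns ranks without indices: a cell meets all others. *)
exists (fun j => if [pick y in P | pos y == j] is Some y then height v w y else 0).
move=> x; case: pickP => [y /andP[yP /eqP yx]|no]; last first.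
  have [y yP /eqP yx] := cell_pos_neq0 x.
  by have := no y; rewrite yP yx.
have leyx : height v w y <= height v w x by apply: (mem_cellP y yP).
split=> //; apply/eqP/mem_cellP => [<- z zx|xmin].
  by apply: (mem_cellP y yP); rewrite zx.
by apply/le_anti; rewrite leyx xmin.
Qed.

(** Both sides are bounded below by the sum over the ranks j of the degree in j
    times the minimal height in rank j, which depends on the multidegree only. A
    monomial attains the bound exactly when its variables have minimal height. *)
Lemma supported_leif a m : multideg a =1 multideg m -> supported P m ->
  \sum_x (m x)%:R * height v w x <= \sum_x (a x)%:R * height v w x
    ?= iff supported P a.
Proof.
have [h hP] := cell_level => dam sm.
pose H (b : {cmonom coord}) := \sum_x (b x)%:R * h (pos x).
have H_le b : H b <= \sum_x (b x)%:R * height v w x ?= iff supported P b.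
  apply: leif_sum => x _; have [->|bx] /= := eqVneq (b x) 0%N.
    by rewrite !mul0r; split; rewrite ?eqxx.
  have b0 : 0 < (b x)%:R :> R by rewrite ltr0n lt0n.
  by split; rewrite ?ler_pM2l ?(inj_eq (mulfI (lt0r_neq0 b0))) // hP.
have H_deg b : H b = \sum_j (multideg b j)%:R * h j.
  rewrite /H (partition_big (@pos n s r) predT) //=; apply/eq_bigr=> j _.
  by rewrite natr_sum mulr_suml; apply/eq_bigr=> x /eqP ->.
have <- : H a = \sum_x (m x)%:R * height v w x.
  have /eqP <- : H m == \sum_x (m x)%:R * height v w x by rewrite H_le.
  by rewrite !H_deg; apply/eq_bigr => j _; rewrite dam.
exact: H_le.
Qed.

(** The degree of p^a for the Z^n-grading, evaluated at v. *)
Definition weight_val a : R := \sum_i (weight a i)%:R * v i.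

Lemma height_split a : \sum_x (a x)%:R * height v w x =
  weight_val a + \sum_x (a x)%:R * w x.
Proof.
under eq_bigr do rewrite mulrDr mulr_sumr.
rewrite big_split /=; congr (_ + _).
rewrite /weight_val; under [RHS]eq_bigr do rewrite natr_sum mulr_suml.
by rewrite (exchange_big_dep predT).
Qed.

Local Notation incl := (char_incl (subsetT P)).
Local Notation J := (initial_ideal (pairing w) (stratum_ideal R T)).

(** On a piece of g homogeneous for the Z^n-grading evaluated at v, having
    minimal height is the same as having minimal w-weight. *)
Lemma cell_gen (f : grpalg C (char_lattice P)) : stratum_gen f -> J (ga_map incl f).
Proof.
move=> [g [m [gV sm dg ->]]].
pose E := exp_diff T ^~ m.
pose X a : grpalg C (char_lattice T) := << g@_a *g E a >>.
(* The graded pieces of g, and their dehomogenizations. *)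
pose gp t := filter_poly g
  (fun c : {ffun 'I_n -> nat} => \sum_i (c i)%:R * v i == t).
have sgp t : msupp (gp t) `<=` msupp g by exact: filter_poly_supp.
pose f_ t := dehomogenize T m (gp t).
(* On the piece t, the w-weight of p^a / p^m is at least c t, with equality
   exactly when a is supported in the cell. *)
pose c t : R := \sum_x (m x)%:R * height v w x - t - \sum_x (m x)%:R * w x.
have fE t : f_ t = \sum_(a <- msupp g) (if weight_val a == t then X a else 0).
  rewrite /f_ (dehomogenizew _ _ (sgp t)); apply/eq_bigr => a _.
  rewrite supported_uniform filter_polyE.
  under [in X in X == t]eq_bigr do rewrite ffunE.
  by rewrite -/(weight_val a); case: ifP; rewrite ?monalgU0.
have pE a : a \in msupp g ->
    pairing w (E a) = \sum_x (a x)%:R * height v w x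
                      - weight_val a - \sum_x (m x)%:R * w x.
  move=> /dg da.
  by rewrite pairing_exp_diff // height_split [weight_val a + _]addrC addrK.
have Jf t : J (part (fun u => pairing w u == c t) (f_ t)).
  apply: part_initial.
    apply: gen_ideal_gen; exists (gp t), m; split => //.
    - exact: filter_poly_vanishes.
    - exact: supported_uniform.
    - by move=> a /(fsubsetP (sgp t)); apply: dg.
  move=> u; rewrite -mcoeff_neq0; apply: contraNT; rewrite -ltNge => wu.
  rewrite fE raddf_sum big_seq big1 // => a ag.
  case: (eqVneq _ t) => [at_|_]; last exact: mcoeff0.
  rewrite [LHS]mcoeffU; case: eqVneq => // Eau.
  have {wu}: pairing w (E a) < c t by rewrite Eau.
  rewrite pE // at_.
  by rewrite /c ltrD2r ltrD2r ltNge (supported_leif (dg _ ag) sm).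
pose T := undup [seq weight_val a | a <- msupp g].
suff -> : ga_map incl (dehomogenize P m g) =
    \sum_(t <- T) part (fun u => pairing w u == c t) (f_ t).
  elim/big_ind: _ => [|p q|t _]; [exact: (ideal0 J)|exact: (@idealD _ J)|exact: Jf].
under eq_bigr do rewrite fE raddf_sum.
rewrite exchange_big (dehomogenizew _ _ (fsubset_refl _)) raddf_sum /=.
rewrite !big_seq; apply/eq_bigr => a ag.
have aT : weight_val a \in T by rewrite mem_undup map_f.
rewrite (bigD1_seq (weight_val a)) ?undup_uniq //= eqxx big1 ?addr0; last first.
  by move=> t; rewrite eq_sym => /negbTE->; rewrite raddf0.
rewrite [RHS]partU pE // /c !(inj_eq (addIr _)) eq_sym (supported_leif (dg _ ag) sm).
case: ifP => sa; last by rewrite raddf0.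
rewrite [LHS]ga_mapU; congr mkmalgU; apply: char_incl_diff => //; exact: dg.
Qed.

(** The coordinates in the cell define a morphism from the initial degeneration
    to the stratum of the cell. *)
Lemma cell_ideal f : stratum_ideal R P f -> J (ga_map incl f).
Proof.
move=> [l lG ->]; rewrite rmorph_sum big_seq.
elim/big_ind: _ => [|b c|q /lG] /=; [exact: (ideal0 J)|exact: (@idealD _ J)|].
by move=> /cell_gen; rewrite rmorphM; apply: (@idealM _ J).
Qed.

End Cell.

(** * Linking Pluecker coordinates through cells *)

Section Connect.
Variable w : coord -> R.

Definition bump_at v i t : 'I_n -> R := fun l => v l + (if l == i then t else 0).

Lemma height_bump v i t x :
  height (bump_at v i t) w x = height v w x + (if i \in sub x then t else 0).
Proof.
rewrite /height big_split /= addrAC; congr (_ + _).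
rewrite -big_mkcondr /=; case: ifP => ix.
  rewrite (big_pred1 i) // => l /=.
  by case: eqP => [->|]; rewrite ?ix ?andbF.
by rewrite big1 // => l /andP[lx /eqP li]; rewrite -li lx in ix.
Qed.

(** Moving v by t in the direction i raises by t the heights of the indices
    containing i and fixes the others. So x stays minimal unless i lies in x, and
    y was already minimal unless i avoids y. In the remaining case x climbs
    until it meets y, when the displacement is the initial height difference of
    x and y; both are minimal there. *)
Lemma cell_bump v i t x y : 0 <= t -> pos x = pos y ->
  x \in cell T w v -> y \in cell T w (bump_at v i t) ->
  exists u, x \in cell T w u /\ y \in cell T w u.
Proof.
move=> t0 xy xv yv.
have hx z : pos z = pos x -> height v w x <= height v w z := mem_cellP _ _ _ xv z.
have hy z : pos z = pos y -> height (bump_at v i t) w y <= height (bump_at v i t) w z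
  := mem_cellP _ _ _ yv z.
have := hx y (esym xy); have := hy x xy; rewrite !height_bump.
case: (boolP (i \in sub y)) => iy; [|case: (boolP (i \in sub x)) => ix] => hyx hxy.
- exists v; split=> //; apply/mem_cellP => z zy.
  have := hx z; rewrite xy => /(_ zy); move: hyx.
  by case: ifP => _ hyx hxz; lra.
- exists (bump_at v i (height v w y - height v w x)).
  split; apply/mem_cellP => z zx; rewrite !height_bump ?ix ?(negbTE iy).
    have := hy z; rewrite -xy => /(_ zx); rewrite !height_bump (negbTE iy).
    by have := hx z zx; case: ifP => _; lra.
  have := hy z zx; rewrite !height_bump (negbTE iy).
  by have := hx z; rewrite xy => /(_ zx); case: ifP => _; lra.
- exists (bump_at v i t); split=> //; apply/mem_cellP => z zx.
  have := hy z; rewrite -xy => /(_ zx).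
  by rewrite !height_bump (negbTE ix) (negbTE iy) => hyz; lra.
Qed.

(** Lowering the coordinates in x by a large amount makes x minimal, since every
    other index of the same rank misses some element of x. *)
Lemma mem_own_cell x : exists v, x \in cell T w v.
Proof.
(* 2 N bounds the differences of the weights w. *)
pose N := \sum_y `|w y|.
have wN y : `|w y| <= N.
  by rewrite /N (bigD1 y) //= lerDl sumr_ge0.
exists (fun i => if i \in sub x then - (2 * N) else 0).
have hE y : \sum_(i in sub y) (if i \in sub x then - (2 * N) else 0) =
    - (2 * N) * #|sub y :&: sub x|%:R.
  rewrite -big_mkcondr /= sumr_const mulr_natr; congr (_ *+ _).
  by apply: eq_card => i; rewrite !inE.
apply/mem_cellP => y yx; rewrite /height !hE setIid.
have := wN x; have := wN y; rewrite !ler_norml => /andP[y1 y2] /andP[x1 x2].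
have cx : #|sub x| = r (pos x) := eqP (valP x).
have cy : #|sub y| = r (pos x) by rewrite -yx; apply: eqP (valP y).
have [xy|xy] := eqVneq (sub x) (sub y).
  suff -> : x = y by rewrite setIid.
  apply/val_inj; move: xy yx; rewrite /sub /pos.
  by case: (val x) (val y) => [??] [??] /= -> ->.
have lt : (#|sub y :&: sub x| < #|sub x|)%N.
  rewrite ltn_neqAle subset_leq_card ?subsetIr // andbT.
  apply: contra xy => /eqP e; rewrite eqEcard cx cy leqnn andbT.
  by apply/setIidPr/eqP; rewrite eqEcard subsetIr e leqnn.
move: lt; rewrite -(ler_nat R) mulrSr.
move: (#|sub y :&: sub x|%:R) (#|sub x|%:R) => p q pq.
have : N * (p + 1) <= N * q by rewrite ler_wpM2l //; lra.
by lra.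
Qed.

Variable G : coord -> coord -> Prop.
Hypothesis G_cell : forall v x y, x \in cell T w v -> y \in cell T w v ->
  pos x = pos y -> G x y.
Hypothesis G_trans : forall y x z, pos x = pos y -> pos y = pos z ->
  G x y -> G y z -> G x z.

(** Move from a cell of x to a cell of y one coordinate at a time, choosing in
    each intermediate cell an index of the same rank; consecutive choices share a
    cell by [cell_bump]. *)
Lemma cell_connected x y : pos x = pos y -> G x y.
Proof.
have G_bump v i t x' y' : pos x' = pos y' ->
    x' \in cell T w v -> y' \in cell T w (bump_at v i t) -> G x' y'.
  move=> xy xv yv; have [t0|t0] := leP 0 t.
    by have [u [xu yu]] := cell_bump t0 xy xv yv; apply: G_cell xu yu xy.
  have vE : bump_at (bump_at v i t) i (- t) = v.
    by apply/funext => l; rewrite /bump_at; case: eqP => _; lra.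
  rewrite -vE in xv; have t0' : 0 <= - t by lra.
  by have [u [yu xu]] := cell_bump t0' (esym xy) yv xv; apply: G_cell xu yu xy.
have [v xv] := mem_own_cell x; have [v' yv'] := mem_own_cell y.
(* Replace the coordinates of v by those of v' one at a time. *)
pose mix (l : seq 'I_n) : 'I_n -> R := fun i => if i \in l then v' i else v i.
have G_mix l : forall y', pos x = pos y' -> y' \in cell T w (mix l) -> G x y'.
  elim: l => [|i l IHl] y' xy' y'v; first exact: G_cell xv y'v xy'.
  have [z zl zx] := cell_pos_neq0 w (mix l) x.
  apply: (G_trans (y := z)) => //; first by rewrite zx.
    exact: IHl.
  have mixE : mix (i :: l) = bump_at (mix l) i (v' i - mix l i).
    apply/funext => j; rewrite /mix /bump_at inE.
    by case: (eqVneq j i) => [->|] /=; [rewrite addrC subrK|rewrite addr0].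
  by rewrite mixE in y'v; apply: (G_bump _ _ _ _ _ _ zl y'v); rewrite zx.
move=> xy; apply: (G_mix (enum 'I_n)) => //.
have -> : mix (enum 'I_n) = v' by apply/funext => i; rewrite /mix mem_enum.
by [].
Qed.

End Connect.

(** * The character lattice *)

(** The character p_x / p_y, for x and y of the same rank. *)
Definition swap_char Q x y : char_lattice Q := exp_diff Q (ucm x) (ucm y).

Lemma multideg_ucm x y : pos x = pos y -> multideg (ucm x) =1 multideg (ucm y).
Proof.
move=> xy j; rewrite /multideg.
have E z : (\sum_(t | pos t == j) ucm z t = (pos z == j))%N.
  under eq_bigr do rewrite cmU.
  rewrite big_mkcond (bigD1 z) //= eqxx big1 ?addn0; first by case: ifP.
  by move=> t /negbTE; rewrite eq_sym => ->; rewrite if_same.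
by apply: etrans (E x) _; rewrite xy; apply: esym (E y).
Qed.

Lemma supported_ucm Q x : x \in Q -> supported Q (ucm x).
Proof.
move=> xQ; apply/forallP=> y; rewrite cmU.
by case: (eqVneq x y) => [<-|_] /=; rewrite ?xQ ?implybT.
Qed.

Lemma swap_charE x y z : pos x = pos y ->
  char_val (swap_char T x y) z = (x == z)%:Z - (y == z)%:Z.
Proof.
move=> xy; rewrite exp_diffE; first last.
- exact: supported_uniform.
- exact: supported_uniform.
- exact: multideg_ucm.
by rewrite ffunE; congr (Posz _ - Posz _); apply: cmU.
Qed.

Lemma swap_charD x y z : pos x = pos y -> pos y = pos z ->
  swap_char T x y + swap_char T y z = swap_char T x z.
Proof.
move=> xy yz; apply: val_inj; rewrite raddfD; apply/ffunP => t; rewrite ffunE /=.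
apply: etrans (congr2 +%R (swap_charE t xy) (swap_charE t yz)) _.
by rewrite addrA subrK; apply/esym/(swap_charE t (etrans xy yz)).
Qed.

Lemma swap_charN x y : pos x = pos y -> - swap_char T x y = swap_char T y x.
Proof.
move=> xy; apply: val_inj; rewrite raddfN; apply/ffunP => t; rewrite ffunE /=.
apply: etrans (congr1 -%R (swap_charE t xy)) _.
by rewrite opprB; apply/esym/(swap_charE t (esym xy)).
Qed.

(** The characters p_x / p_y generate the lattice as a monoid: pick a base index
    b x in the rank of x; a vector u whose sum over each rank is zero is the sum
    of the u_x (e_x - e_(b x)), as the base contributions cancel. *)
Lemma char_lattice_ind (G : char_lattice T -> Prop) :
  G 0 -> (forall u t, G u -> G t -> G (u + t)) ->
  (forall x y, pos x = pos y -> G (swap_char T x y)) -> forall u, G u.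
Proof.
move=> G0 GD Gxy u.
have GMn t p : G t -> G (t *+ p).
  by move=> Gt; elim: p => [|p IHp]; rewrite ?mulr0n // mulrS; apply: GD.
have GMz x y (p : int) : pos x = pos y -> G (swap_char T x y *~ p).
  case: p => p xy; first exact/GMn/Gxy.
  by rewrite NegzE mulrNz -mulNrz swap_charN //; apply/GMn/Gxy.
pose b x : coord := if [pick y | pos y == pos x] is Some y then y else x.
have bx x : pos x = pos (b x).
  by rewrite /b; case: pickP => // y /eqP.
have b_pos x y : pos x = pos y -> b x = b y.
  by move=> xy; rewrite /b xy; case: pickP => // /(_ y); rewrite eqxx.
have [_ u0] := char_predP _ _ (char_valP u).
suff -> : u = \sum_x swap_char T x (b x) *~ char_val u x.
  by elim/big_ind: _ => // x _; apply: GMz.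
apply: val_inj; rewrite raddf_sum; apply/ffunP => z; rewrite sum_ffunE.
have E x : (val (swap_char T x (b x) *~ char_val u x) : {ffun coord -> int}) z =
    (x == z)%:Z * char_val u x - (b x == z)%:Z * char_val u x.
  rewrite -mulrBl -(swap_charE _ (bx x)).
  by rewrite raddfMz ffunMzE -mulrzz.
rewrite (eq_bigr _ (fun x _ => E x)) sumrB (bigD1 z) //= eqxx mul1r big1 ?addr0.
  (* [b] is constant on each rank, so the base terms add up to zero. *)
  rewrite [X in _ - X](partition_big (@pos n s r) predT) //= big1 ?subr0 // => j _.
  have [y yj|no] := pickP (fun y => pos y == j); last first.
    by rewrite big1 // => x; rewrite no.
  rewrite (eq_bigr (fun x => (b y == z)%:Z * char_val u x)).
    by rewrite -mulr_sumr u0 mulr0.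
  by move=> x /eqP xj; rewrite (b_pos x y) // xj (eqP yj).
by move=> x /negbTE->; rewrite mul0r.
Qed.

(** * The morphism to the limit *)

Section ToLimit.
Variable w : coord -> R.
Local Notation J := (initial_ideal (pairing w) (stratum_ideal R T)).
Local Notation cells := {P : {set coord} | P \in subdivision w}.

Lemma subdivision_ideal P (PT : P \subset T) : P \in subdivision w ->
  forall f, stratum_ideal R P f -> J (ga_map (char_incl PT) f).
Proof.
rewrite inE => /asboolP[v PE] f; move: PT f; rewrite PE => PT f /cell_ideal.
by rewrite (bool_irrelevance PT (subsetT _)).
Qed.

Section Leg.
Variable P : cells.

Definition in_Fl_pull :
    {rmorphism coord_ring (stratum R (val P)) -> coord_ring (in_Fl w)} :=
  quot_map (@subdivision_ideal _ (subsetT _) (valP P)).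

Lemma in_Fl_pullE f : in_Fl_pull (quot_pi (stratum_ideal R (val P)) f) =
  quot_pi J (ga_map (char_incl (subsetT (val P))) f).
Proof. exact: quot_mapE. Qed.

Lemma in_Fl_pull_str c :
  in_Fl_pull (coord_ring_str (stratum R (val P)) c) = coord_ring_str (in_Fl w) c.
Proof.
rewrite [LHS]in_Fl_pullE /=; congr quot_pi.
by rewrite [LHS]ga_mapU raddf0.
Qed.

Definition in_Fl_proj : scheme_hom (in_Fl w) (stratum R (val P)) :=
  SchemeHom in_Fl_pull_str.

End Leg.

Lemma ga_map_comp (P Q S : {set coord}) (PQ : P \subset Q) (QS : Q \subset S)
    (PS : P \subset S) (f : grpalg C (char_lattice P)) :
  ga_map (char_incl QS) (ga_map (char_incl PQ) f) = ga_map (char_incl PS) f.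
Proof.
rewrite {2}/ga_map raddf_sum; apply/eq_bigr => u _.
by rewrite [LHS]ga_mapU; congr mkmalgU; apply: char_incl_trans.
Qed.

Lemma in_Fl_proj_comm (P Q : cells) (PQ : face R (val P) (val Q)) :
  factors (in_Fl_proj P) (in_Fl_proj Q) (face_morphism PQ).
Proof.
elim/quot_pi_ind => f; rewrite [LHS]in_Fl_pullE.
rewrite [pull (face_morphism PQ) _]quot_mapE [RHS]in_Fl_pullE.
by congr quot_pi; apply/esym/ga_map_comp.
Qed.

Definition in_Fl_cone : subdivision_cone w := Cone in_Fl_proj_comm.

(** The image of the pullback is a subring containing the constants, and by
    [cell_connected] and [char_lattice_ind] all characters. *)
Lemma in_Fl_cone_closed_immersion (L : subdivision_cone w)
    (f : scheme_hom (in_Fl w) (apex L)) :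
  (forall P : cells, factors (proj in_Fl_cone P) f (proj L P)) -> closed_immersion f.
Proof.
move=> fL.
pose im (b : coord_ring (in_Fl w)) := exists a : coord_ring (apex L), pull f a = b.
have imM b b' : im b -> im b' -> im (b * b').
  by move=> [a <-] [a' <-]; exists (a * a'); rewrite rmorphM.
pose chr u : grpalg C (char_lattice T) := << 1 *g u >>.
have chrD u t : quot_pi J (chr (u + t)) = quot_pi J (chr u) * quot_pi J (chr t).
  by rewrite -(rmorphM (quot_pi J)); congr quot_pi; rewrite [RHS]ga_mulUU mulr1.
have im_chrD u t : im (quot_pi J (chr u)) -> im (quot_pi J (chr t)) ->
    im (quot_pi J (chr (u + t))).
  by rewrite chrD; apply: imM.
have im_chr0 : im (quot_pi J (chr 0)) by exists 1; rewrite !rmorph1.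
have im_chr u : im (quot_pi J (chr u)).
  move: u; apply: (char_lattice_ind im_chr0) => // x y.
  apply: (@cell_connected w (fun x y => im (quot_pi J (chr (swap_char T x y)))))
    => {x y} [v x y xv yv xy|y x z xy yz].
    (* Within a cell the character is already a function on its stratum. *)
    have PS : cell T w v \in subdivision w by rewrite inE; apply/asboolP; exists v.
    pose P : cells := Sub (cell T w v) PS.
    pose h : grpalg C (char_lattice (val P)) := << 1 *g swap_char (val P) x y >>.
    exists (pull (proj L P) (quot_pi (stratum_ideal R (val P)) h)).
    rewrite -fL [LHS]in_Fl_pullE; congr quot_pi.
    rewrite [LHS]ga_mapU; congr mkmalgU.
    by apply: char_incl_diff; [apply: multideg_ucm|apply: supported_ucm..].
  by rewrite -(swap_charD xy yz); apply: im_chrD.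
elim/quot_pi_ind => g; rewrite (monalgE g) rmorph_sum.
elim/big_ind: _ => [|b b' [a <-] [a' <-]|u _].
- by exists 0; rewrite rmorph0.
- by exists (a + a'); rewrite rmorphD.
have [a aE] := im_chr u; exists (coord_ring_str (apex L) g@_u * a).
rewrite rmorphM aE pull_str /= -(rmorphM (quot_pi J)); congr quot_pi.
by rewrite [LHS]ga_mulUU mulr1 add0r.
Qed.

End ToLimit.
End Strata.

Theorem theorem1p1 (R : realType) (n s : nat) (r : 'I_s -> nat)
    (n_ge1 : (1 <= n)%N)
    (r_bounds : forall j : 'I_s, (0 < r j < n)%N)
    (r_increasing : forall i j : 'I_s, (i < j)%N -> (r i < r j)%N)
    (w : plucker_index n r -> R) (w_trop : TFl w) :
  exists L : subdivision_cone w, is_limit L /\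
    exists f : scheme_hom (in_Fl w) (apex L), closed_immersion f.
Proof.
exists (limit_cone _); split; first exact: limit_cone_is_limit.
have [f [fL _]] := limit_cone_is_limit (in_Fl_cone w).
by exists f; apply: in_Fl_cone_closed_immersion fL.
Qed.
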